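(* Let $K$ be a totally real Galois extension of $\mathbb{Q}$, and let $n\ge 1$ and $m\ge 1$ be integers. If $f\in\mathbb{Q}[x_1,\ldots,x_n]$ can be written as $f=\sum_{k=1}^m f_k^2$ with $f_1,\ldots,f_m\in K[x_1,\ldots,x_n]$, then $f$ is a sum of $(4[K:\mathbb{Q}]-3)\cdot m$ squares of polynomials in $\mathbb{Q}[x_1,\ldots,x_n]$.
   Context: A number field $K$ is totally real if every field embedding $K\hookrightarrow\mathbb{C}$ has image contained in $\mathbb{R}$. $[K:\mathbb{Q}]$ denotes the degree of $K$ over $\mathbb{Q}$. *)

(* Defs.v *)
From HB Require Import structures.
From mathcomp Require Import all_boot all_order all_algebra all_field.
From mathcomp Require Import reals complex mpoly.

Set Implicit Arguments.
Unset Strict Implicit.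
Unset Printing Implicit Defensive.

Import GRing.Theory.
Local Open Scope ring_scope.

(* [R] plays the role of the real numbers (any two [realType]s are isomorphic
   ordered fields) and [R[i]] that of the complex numbers.  Ring morphisms
   between fields are injective and Q-linear, so they are exactly the field
   embeddings. *)
Definition totally_real (R : realType) (K : fieldExtType rat) : Prop :=
  forall (phi : {rmorphism K -> R[i]}) (x : K),
    exists r : R, phi x = real_complex R r.

(* Main.v *)
(** Let [T = Tr / d] with [d = [K : Q]].  Applying [T] to the coefficients of
    [f = sum_k f_k^2] fixes [f], so it suffices to write [T (p^2)] as a sum of
    [4d - 3] squares for each [p] over [K].  Expanding [p] in a Q-basis
    [b_0 = 1, ..., b_{d-1}] of [K], with coordinates [h_i] over Q, gives
    [T (p^2) = sum_{i,j} T (b_i b_j) h_i h_j].  This quadratic form is positive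
    definite because [K] is totally real, and completing squares turns it into
    [sum_i a_i l_i^2] with [a_i > 0] rational.  By Lagrange's theorem each [a_i]
    is a sum of four rational squares, except that [a_0 = T 1 = 1] needs only
    one: [1 + 4 (d - 1) = 4d - 3]. *)

From HB Require Import structures.
Require Import Defs.
From mathcomp Require Import all_boot all_order all_algebra all_field.
From mathcomp Require Import reals complex mpoly.
From mathcomp Require Import ring zify.

Set Implicit Arguments.
Unset Strict Implicit.
Unset Printing Implicit Defensive.

Import GRing.Theory.
Local Open Scope ring_scope.
Import Order.TTheory Num.Theory.

(** * Sums of a prescribed number of squares *)

Definition sum_of_squares (A : comNzRingType) (N : nat) (x : A) : Prop :=
  exists g : 'I_N -> A, x = \sum_(k < N) g k ^+ 2.

Lemma sum_of_squares1 (A : comNzRingType) (x : A) : sum_of_squares 1 (x ^+ 2).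
Proof. by exists (fun=> x); rewrite big_ord1. Qed.

Lemma sum_of_squaresD (A : comNzRingType) (N M : nat) (x y : A) :
  sum_of_squares N x -> sum_of_squares M y -> sum_of_squares (N + M) (x + y).
Proof.
move=> [g ->] [h ->].
exists (fun k => match split k with inl i => g i | inr j => h j end).
rewrite big_split_ord /=; congr (_ + _); apply: eq_bigr => i _.
  by rewrite (unsplitK (inl i)).
by rewrite (unsplitK (inr i)).
Qed.

Lemma sum_of_squares_sum (A : comNzRingType) (N m : nat) (x : 'I_m -> A) :
  (forall k, sum_of_squares N (x k)) ->
  sum_of_squares (N * m) (\sum_(k < m) x k).
Proof.
elim: m x => [|m IHm] x sos_x.
  by rewrite big_ord0 muln0; exists (fun=> 0); rewrite big_ord0.
rewrite big_ord_recl mulnS; apply: sum_of_squaresD; first exact: sos_x.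
by apply: IHm => k; apply: sos_x.
Qed.

(** * Lagrange's four-square theorem over the rationals *)

Definition four_squares (A : comNzRingType) (x : A) : Prop :=
  exists a b c d : A, x = a ^+ 2 + b ^+ 2 + c ^+ 2 + d ^+ 2.

(** Euler's identity: the witnesses are the coordinates of a product of two quaternions, whose norm
    is multiplicative. *)
Lemma four_squaresM (A : comNzRingType) (x y : A) :
  four_squares x -> four_squares y -> four_squares (x * y).
Proof.
move=> [a [b [c [d ->]]]] [p [q [r [s ->]]]].
exists (a * p - b * q - c * r - d * s), (a * q + b * p + c * s - d * r),
  (a * r - b * s + c * p + d * q), (a * s + b * r - c * q + d * p).
ring.
Qed.

Lemma four_squaresV (F : fieldType) (x : F) :
  four_squares x -> four_squares x^-1.
Proof.
have [-> _|x_neq0 x4] := eqVneq x 0.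
  by rewrite invr0; exists 0, 0, 0, 0; rewrite expr0n !addr0.
have -> : x^-1 = x * x^-1 ^+ 2 by field.
by apply: four_squaresM x4 _; exists x^-1, 0, 0, 0; rewrite expr0n !addr0.
Qed.

(** For [i <= j], [p] divides [j - i] or [j + i]. Both are smaller than [p], so the one it divides
    is zero. *)
Lemma sqr_natr_Fp_inj (p i j : nat) : prime p ->
  (i.*2 < p)%N -> (j.*2 < p)%N ->
  i%:R ^+ 2 = j%:R ^+ 2 :> 'F_p -> i = j.
Proof.
move=> p_pr; wlog le_ij : i j / (i <= j)%N => [hw i_p j_p ij2|].
  by case: (leqP i j) => [|/ltnW] le; [apply: hw | apply/esym/hw].
move=> i_p j_p /eqP; rewrite eq_sym -subr_eq0 subr_sqr -natrB // -natrD mulf_eq0.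
rewrite -!(dvdn_pcharf (pchar_Fp p_pr)) => /orP[] /dvdnP [k].
  by case: k => [|k]; nia.
by case: k => [|k]; nia.
Qed.

(** Pigeonhole: with [p = 2h + 1], the [h + 1] values [i ^ 2] and the [h + 1] values [-(1 + j ^ 2)]
    cannot be disjoint in ['F_p]. The bound on [m] is what lets a strong induction on [p] reach
    [m]. *)
Lemma sum_two_squares_modp (p : nat) : prime p -> odd p ->
  exists a b m : nat, (a ^ 2 + b ^ 2 + 1 = m * p)%N /\ (m < p)%N.
Proof.
move=> p_pr p_odd; pose h := p./2.
have p_h : p = h.*2.+1 by rewrite -[LHS]odd_double_half p_odd.
pose F (i : 'I_h.+1) : 'F_p := i%:R ^+ 2.
pose G (i : 'I_h.+1) : 'F_p := - (1 + i%:R ^+ 2).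
have small (i : 'I_h.+1) : (i.*2 < p)%N by have := ltn_ord i; lia.
have F_inj : injective F.
  by move=> i j /(sqr_natr_Fp_inj p_pr (small i) (small j))/val_inj.
have G_inj : injective G by move=> i j /oppr_inj/addrI/F_inj.
have [i [j Fij]] : exists i j, F i = G j.
  have [/pred0P dis|/pred0Pn[x /andP[/imsetP[i _ ->] /imsetP[j _ Fij]]]] :=
    boolP [disjoint F @: setT & G @: setT]; last by exists i, j.
  have : [disjoint F @: setT & G @: setT] by apply/pred0P.
  rewrite -leq_card_setU => /eqP card_eq.
  have := leq_trans (max_card (mem (F @: setT :|: G @: setT)))
                    (eq_leq (card_Fp p_pr)).
  rewrite card_eq !card_imset // !cardsT !card_ord; lia.
have /dvdnP [m def_m] : (p %| i ^ 2 + j ^ 2 + 1)%N.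
  rewrite (dvdn_pcharf (pchar_Fp p_pr)) !natrD !natrX.
  by move: Fij; rewrite /F /G => ->; apply/eqP; ring.
exists i, j, m; split=> //.
rewrite -(ltn_pmul2r (prime_gt0 p_pr)) -def_m.
(* Thus [m * p <= 2 * h ^ 2 + 1 < p ^ 2]. *)
have sqr_le (k : 'I_h.+1) : (k ^ 2 <= h ^ 2)%N by rewrite leq_sqr -ltnS ltn_ord.
have := sqr_le i; have := sqr_le j; have := prime_gt1 p_pr; nia.
Qed.

(* Over Q the descent on [m] in Lagrange's proof is unnecessary: [m p] and [m]
   are sums of four squares, hence so is their quotient [p]. *)
Lemma four_squares_natr (n : nat) : four_squares (n%:R : rat).
Proof.
elim/ltn_ind: n => n IHn.
have [n_le1|n_gt1] := leqP n 1.
  by exists n%:R, 0, 0, 0; rewrite expr0n !addr0; case: n n_le1 {IHn} => [|[]].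
have [n_pr|/primePn[|[d /andP[d_gt1 d_ltn] /dvdnP[q def_n]]]] :=
  boolP (prime n); last 2 first.
- by rewrite ltnNge n_gt1.
- rewrite def_n natrM; apply: four_squaresM; apply: IHn => //; nia.
have [n2|n_odd] := even_prime n_pr.
  by exists 1, 1, 0, 0; rewrite n2; ring.
have [a [b [m [abm m_lt]]]] := sum_two_squares_modp n_pr n_odd.
have m_neq0 : m%:R != 0 :> rat.
  by rewrite pnatr_eq0; apply: contra_eqN abm => /eqP ->; rewrite addn1.
have -> : n%:R = (m%:R * n%:R) * m%:R^-1 :> rat by field.
apply: four_squaresM; last by apply: four_squaresV; apply: IHn.
exists a%:R, b%:R, 1, 0; rewrite -natrM -abm !natrD !natrX; ring.
Qed.

Lemma four_squares_rat (x : rat) : 0 <= x -> four_squares x.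
Proof.
move=> x_ge0; rewrite -[x]divq_num_den.
have : 0 <= numq x by rewrite numq_ge0.
have := denq_ge0 x.
case: (denq x) (numq x) => // d [] // k _ _.
by apply: four_squaresM; [|apply: four_squaresV]; apply: four_squares_natr.
Qed.

(** * Diagonalising positive definite quadratic forms *)

(** The arguments live in an algebra so that one form [B] can be tested for positivity on scalar
    vectors ([A := F^o]) and then evaluated at polynomials. *)
Definition quad (F : fieldType) (A : comAlgType F) (d : nat)
    (B : 'I_d -> 'I_d -> F) (h : 'I_d -> A) : A :=
  \sum_i \sum_j B i j *: (h i * h j).

Definition schur_complement (F : fieldType) (d : nat)
    (B : 'I_d.+1 -> 'I_d.+1 -> F) (i j : 'I_d) : F :=
  B (lift ord0 i) (lift ord0 j)
  - B ord0 (lift ord0 i) * B ord0 (lift ord0 j) / B ord0 ord0.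

Lemma quad_complete_square (F : fieldType) (A : comAlgType F) (d : nat)
    (B : 'I_d.+1 -> 'I_d.+1 -> F) (h : 'I_d.+1 -> A) :
  (forall i j, B i j = B j i) -> B ord0 ord0 != 0 ->
  quad B h =
    B ord0 ord0 *:
      (h ord0
       + \sum_j (B ord0 (lift ord0 j) / B ord0 ord0) *: h (lift ord0 j)) ^+ 2
    + quad (schur_complement B) (fun j => h (lift ord0 j)).
Proof.
move=> B_sym B_neq0; set s := \sum_j _; set a := B ord0 ord0.
have a_s : a *: s = \sum_j B ord0 (lift ord0 j) *: h (lift ord0 j).
  rewrite scaler_sumr; apply: eq_bigr => j _.
  by rewrite scalerA mulrC divfK.
have h_s : \sum_j B ord0 (lift ord0 j) *: (h ord0 * h (lift ord0 j))
    = h ord0 * (a *: s).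
  by rewrite a_s mulr_sumr; apply: eq_bigr => j _; rewrite scalerAr.
have s_s : quad (schur_complement B) (fun j => h (lift ord0 j))
    = \sum_i \sum_j B (lift ord0 i) (lift ord0 j)
        *: (h (lift ord0 i) * h (lift ord0 j)) - a *: s ^+ 2.
  rewrite expr2 scalerAl a_s mulr_suml -sumrB; apply: eq_bigr => i _.
  rewrite mulr_sumr -sumrB; apply: eq_bigr => j _.
  by rewrite -scalerAl -scalerAr scalerA -scalerBl mulrA.
rewrite s_s /quad big_ord_recl big_ord_recl -/a h_s.
under eq_bigr do rewrite big_ord_recl B_sym mulrC.
rewrite big_split /= h_s sqrrD mulr2n !scalerDr -!scalerAr -expr2.
ring.
Qed.

Lemma quad_posdef_schur (F : realFieldType) (d : nat)
    (B : 'I_d.+1 -> 'I_d.+1 -> F) :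
  (forall i j, B i j = B j i) ->
  (forall v : 'I_d.+1 -> F, (exists i, v i != 0) -> 0 < quad (A := F^o) B v) ->
  [/\ 0 < B ord0 ord0,
      forall i j, schur_complement B i j = schur_complement B j i &
      forall v : 'I_d -> F, (exists i, v i != 0) ->
        0 < quad (A := F^o) (schur_complement B) v].
Proof.
move=> B_sym B_pos.
have B00 : 0 < B ord0 ord0.
  have := B_pos (fun i => (i == ord0)%:R); rewrite /quad big_ord_recl.
  rewrite big_ord_recl eqxx !big1 ?addr0 => [|i _|i _].
  - by rewrite mulr1 [_ *: _]mulr1; apply; exists ord0; rewrite eqxx oner_neq0.
  - by rewrite big1 // => j _; rewrite mul0r scaler0.
  - by rewrite mulr0 scaler0.
split=> // [i j|v [i vi]].
  by rewrite /schur_complement B_sym; congr (_ - _ / _); rewrite mulrC.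
pose s := \sum_j (B ord0 (lift ord0 j) / B ord0 ord0) * v j.
(* The zeroth coordinate [- s] kills the completed square, so [B] at [w] equals the Schur complement
   at [v]. *)
pose w k := if unlift ord0 k is Some j then v j else - s.
have w0 : w ord0 = - s by rewrite /w unlift_none.
have wl j : w (lift ord0 j) = v j by rewrite /w liftK.
have : 0 < quad (A := F^o) B w by apply: B_pos; exists (lift ord0 i); rewrite wl.
rewrite quad_complete_square ?gt_eqF // w0.
under eq_bigr do rewrite wl.
rewrite addNr expr0n scaler0 add0r /quad.
by under eq_bigr do under eq_bigr do rewrite !wl.
Qed.

Lemma sum_of_squares_scale (A : comAlgType rat) (a : rat) (x : A) :
  0 <= a -> sum_of_squares 4 (a *: x ^+ 2).
Proof.
move=> /four_squares_rat[p [q [r [s ->]]]].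
have scale_sqr (c : rat) : sum_of_squares 1 (c ^+ 2 *: x ^+ 2).
  by rewrite -exprZn; apply: sum_of_squares1.
rewrite !scalerDl; apply: (@sum_of_squaresD _ 3 1) => //.
by apply: (@sum_of_squaresD _ 2 1) => //; apply: (@sum_of_squaresD _ 1 1).
Qed.

Lemma quad_posdef_sum_of_squares (A : comAlgType rat) (d : nat)
    (B : 'I_d -> 'I_d -> rat) (h : 'I_d -> A) :
  (forall i j, B i j = B j i) ->
  (forall v : 'I_d -> rat, (exists i, v i != 0) -> 0 < quad (A := rat^o) B v) ->
  sum_of_squares (4 * d) (quad B h).
Proof.
elim: d B h => [|d IHd] B h B_sym B_pos.
  by rewrite /quad big_ord0 muln0; exists (fun=> 0); rewrite big_ord0.
have [B00 S_sym S_pos] := quad_posdef_schur B_sym B_pos.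
rewrite quad_complete_square ?gt_eqF // mulnS.
apply: sum_of_squaresD; last exact: IHd.
by apply: sum_of_squares_scale; apply: ltW.
Qed.

Lemma quad_posdef_sum_of_squares1 (A : comAlgType rat) (d : nat)
    (B : 'I_d.+1 -> 'I_d.+1 -> rat) (h : 'I_d.+1 -> A) :
  (forall i j, B i j = B j i) ->
  (forall v : 'I_d.+1 -> rat, (exists i, v i != 0) ->
    0 < quad (A := rat^o) B v) ->
  B ord0 ord0 = 1 ->
  sum_of_squares (4 * d.+1 - 3) (quad B h).
Proof.
move=> B_sym B_pos B00.
have [B00_gt0 S_sym S_pos] := quad_posdef_schur B_sym B_pos.
rewrite quad_complete_square ?gt_eqF // B00 scale1r.
have -> : (4 * d.+1 - 3 = 1 + 4 * d)%N by lia.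
apply: sum_of_squaresD; first exact: sum_of_squares1.
exact: quad_posdef_sum_of_squares.
Qed.

(** * Complex embeddings and positivity of the trace *)

(** [totally_real] quantifies over all embeddings, so using it takes at least one. With [z] a
    primitive element and [w] a root in [C] of its minimal polynomial, [p(z)] is sent to [p(w)]. *)
Lemma number_field_embedding (L : fieldExtType rat) (C : numClosedFieldType) :
  inhabited {rmorphism L -> C}.
Proof.
have sep : separable 1 {:L}.
  apply/separableP => x _; apply: pcharf0_separable => p.
  by rewrite pchar_lalg pchar_num.
have L_z := eq_adjoin_separable_generator sep (sub1v _).
set z := separable_generator _ _ in L_z.
have /polyOver1P[q def_q] : minPoly 1 z \is a polyOver 1%VS := minPolyOver _ _.
have [w qw0] : exists w, root (map_poly (ratr : rat -> C) q) w.
  apply/closed_rootP; rewrite size_map_poly -(size_map_poly (in_alg L)) -def_q.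
  by rewrite size_minPoly.
have P x : {p : {poly rat} | x = (map_poly (in_alg L) p).[z]}.
  by apply: sig_eqW; apply/Fadjoin1_polyP; rewrite -L_z memvf.
pose phi x := (map_poly (ratr : rat -> C) (sval (P x))).[w].
(* Independence of the chosen representative: two polynomials agreeing at [z] differ by a multiple
   of [q], which vanishes at [w]. *)
have phiE p : phi (map_poly (in_alg L) p).[z] = (map_poly ratr p).[w].
  rewrite /phi; case: (P _) => r /= /eqP.
  rewrite -subr_eq0 -hornerN -hornerD -rmorphB.
  move=> /(minPoly_dvdp (alg_polyOver 1%AS _)); rewrite def_q dvdp_map.
  move=> /dvdpP[s prs].
  apply/eqP; rewrite eq_sym -subr_eq0 -hornerN -hornerD -rmorphB prs.
  by rewrite rmorphM hornerM (rootP qw0) mulr0.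
have phiB : zmod_morphism phi.
  move=> x y; have [p ->] := P x; have [r ->] := P y.
  by rewrite -hornerN -hornerD -rmorphB !phiE rmorphB hornerD hornerN.
have phiM : monoid_morphism phi.
  split=> [|x y]; first by have := phiE 1; rewrite !rmorph1 !hornerC.
  have [p ->] := P x; have [r ->] := P y.
  by rewrite -hornerM -rmorphM !phiE rmorphM hornerM.
constructor.
pose phiAdd := GRing.isZmodMorphism.Build L C phi phiB.
pose phiMul := GRing.isMonoidMorphism.Build L C phi phiM.
exact: (HB.pack_for {rmorphism L -> C} phi phiAdd phiMul).
Qed.

(** Under one embedding [phi], each conjugate of [x ^+ 2] becomes the square of a nonzero real. The
    sign of the rational trace can be read off in [R[i]]. *)
Lemma galTrace_sqr_gt0 (R : realType) (K : splittingFieldType rat) (x : K) :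
  galois 1%AS {:K}%AS -> totally_real R K -> x != 0 ->
  exists2 a : rat, 0 < a & galTrace 1%AS {:K}%AS (x ^+ 2) = a%:A.
Proof.
move=> K_galois K_real x_neq0.
have /vlineP[a tr_x] : galTrace 1%AS {:K}%AS (x ^+ 2) \in 1%VS.
  by apply: mem_galTrace K_galois (memvf _).
exists a => //; have [phi] := number_field_embedding K R[i].
have sqr_gt0 (y : K) : y != 0 -> 0 < phi y ^+ 2.
  move=> y_neq0; have [r phi_y] := K_real phi y.
  rewrite phi_y -rmorphXn ltcR exprn_even_gt0 //=.
  apply: contra_neq y_neq0 => r0; apply: (fmorph_inj phi).
  by rewrite phi_y r0 !rmorph0.
rewrite -(ltr0q R[i]) -(fmorph_rat phi) -alg_num_field -tr_x /galTrace.
(* The identity automorphism supplies a strictly positive term; the others need only be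
   nonnegative. *)
rewrite (bigD1 (1%g : gal_of {:K})) ?group1 //= rmorphD ltr_wpDr //.
  rewrite rmorph_sum sumr_ge0 // => s _.
  by rewrite !rmorphXn ltW // sqr_gt0 // fmorph_eq0.
by rewrite !rmorphXn sqr_gt0 // fmorph_eq0.
Qed.

Lemma basis_with_one (F : fieldType) (L : fieldExtType F) :
  exists (d : nat) (b : d.+1.-tuple L), basis_of {:L} b /\ b`_0 = 1.
Proof.
exists (\dim (1%VS : {vspace L})^C).
exists [tuple of 1 :: vbasis (1%VS : {vspace L})^C].
split=> //; rewrite -(addv_complf 1%VS); apply: (@cat_basis _ _ _ _ [:: 1]).
- by apply/directv_addP; apply: capv_compl.
- by apply: seq1_basis; apply: oner_neq0.
- exact: vbasisP.
Qed.

Lemma normalized_trace (R : realType) (K : splittingFieldType rat) :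
  galois 1%AS {:K}%AS -> totally_real R K ->
  exists T : {linear K -> rat^o},
    T 1 = 1 /\ forall x : K, x != 0 -> 0 < (T (x ^+ 2) : rat).
Proof.
move=> K_galois K_real.
have [d [b [b_basis b0]]] := basis_with_one K.
pose Tr : 'End(K) := \sum_(s in ('Gal({:K} / 1))%g) (s : 'End(K)).
have TrE x : Tr x = galTrace 1%AS {:K}%AS x by rewrite sum_lfunE.
(* Since [b_0 = 1], this coordinate reads a rational back from its image in [K]. *)
have coord1 (a : rat) : coord b ord0 a%:A = a.
  by rewrite linearZ -b0 /= (coord_free ord0 ord0 (basis_free b_basis)) mulr1.
pose n : rat := (\dim {:K})%:R.
have n_gt0 : 0 < n by rewrite ltr0n adim_gt0.
pose T : 'Hom(K, rat^o) := n^-1 *: (linfun (coord b ord0 : K -> rat^o) \o Tr)%VF.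
have TE x : T x = n^-1 * coord b ord0 (galTrace 1%AS {:K}%AS x).
  by rewrite scale_lfunE comp_lfunE lfunE TrE.
have T1 : T 1 = 1.
  rewrite TE /galTrace; under eq_bigr do rewrite rmorph1.
  (* The trace of 1 is the order of the Galois group, which is the degree. *)
  rewrite sumr_const -(galois_dim K_galois) dimv1 divn1 -scaler_nat coord1.
  by rewrite mulVf ?gt_eqF.
exists T; split=> // x x_neq0.
have [a a_gt0 tr_x] := galTrace_sqr_gt0 K_galois K_real x_neq0.
rewrite -[X in 0 < X]/(T (x ^+ 2)) TE tr_x coord1.
by rewrite mulr_gt0 ?invr_gt0.
Qed.

(** * Applying the normalized trace to coefficients *)

(** Serves twice: with [c] a product of basis elements it yields the entries of the Gram matrix, and
    with [c = 1] it shows that [T] fixes rational polynomials. *)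
Lemma map_mpoly_scale_alg (L : fieldExtType rat) (T : {linear L -> rat^o})
    (n : nat) (c : L) (g : {mpoly rat[n]}) :
  map_mpoly T (c *: map_mpoly (in_alg L) g) = (T c : rat) *: g.
Proof.
apply/mpolyP => mon; rewrite mcoeffZ mcoeff_map_mpoly mcoeffZ mcoeff_map_mpoly /=.
by rewrite -scalerAr mulr1 linearZ mulrC.
Qed.

Lemma map_mpoly_sqr_sum_of_squares (L : fieldExtType rat)
    (T : {linear L -> rat^o}) (n : nat) (p : {mpoly L[n]}) :
  T 1 = 1 -> (forall x : L, x != 0 -> 0 < (T (x ^+ 2) : rat)) ->
  sum_of_squares (4 * \dim {:L} - 3) (map_mpoly T (p ^+ 2) : {mpoly rat[n]}).
Proof.
move=> T1 T_pos; have [d [b [b_basis b0]]] := basis_with_one L.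
pose h i : {mpoly rat[n]} := map_mpoly (coord b i) p.
pose B (i j : 'I_d.+1) : rat := T (b`_i * b`_j).
have p_h : p = \sum_(i < d.+1) b`_i *: map_mpoly (in_alg L) (h i).
  apply/mpolyP => mon; rewrite raddf_sum /= [LHS](coord_basis b_basis) ?memvf //.
  apply: eq_bigr => i _; rewrite mcoeffZ !mcoeff_map_mpoly /=.
  by rewrite -scalerAr mulr1.
have -> : map_mpoly T (p ^+ 2) = quad B h.
  rewrite expr2 {1}p_h mulr_suml raddf_sum; apply: eq_bigr => i _.
  rewrite p_h mulr_sumr raddf_sum; apply: eq_bigr => j _.
  rewrite -scalerAl -scalerAr scalerA -rmorphM.
  exact: map_mpoly_scale_alg.
rewrite (vector.size_basis b_basis); apply: quad_posdef_sum_of_squares1.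
- by move=> i j; rewrite /B mulrC.
- move=> v [i vi]; pose x := \sum_(i < d.+1) v i *: b`_i.
  (* [B] is the Gram matrix of the trace form, and freeness of [b] makes [x] nonzero when [v] is. *)
  have -> : quad (A := rat^o) B v = T (x ^+ 2).
    rewrite expr2 mulr_suml linear_sum; apply: eq_bigr => k _.
    rewrite mulr_sumr linear_sum; apply: eq_bigr => l _.
    rewrite -scalerAl -scalerAr !linearZ.
    by congr (_ *: _); apply: mulrC.
  apply: T_pos; apply: contra_neq vi => x0.
  by move/freeP: (basis_free b_basis); apply.
- by rewrite /B b0 mulr1.
Qed.

Unset Implicit Arguments.

Theorem theorem3p1 (R : realType) (K : splittingFieldType rat)
    (K_galois : galois 1%AS {:K}%AS) (K_real : totally_real R K)
    (n m : nat) (n_ge1 : (1 <= n)%N) (m_ge1 : (1 <= m)%N)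
    (f : {mpoly rat[n]}) (fs : 'I_m -> {mpoly K[n]})
    (f_sos : map_mpoly (in_alg K) f = \sum_(k < m) fs k ^+ 2) :
  exists g : 'I_((4 * \dim {:K} - 3) * m) -> {mpoly rat[n]},
    f = \sum_(k < (4 * \dim {:K} - 3) * m) g k ^+ 2.
Proof.
have [T [T1 T_pos]] := normalized_trace K_galois K_real.
have -> : f = \sum_(k < m) map_mpoly T (fs k ^+ 2).
  rewrite -raddf_sum -f_sos.
  by have := map_mpoly_scale_alg T 1 f; rewrite T1 !scale1r => /esym.
by apply: sum_of_squares_sum => k; apply: map_mpoly_sqr_sum_of_squares.
Qed.
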